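(* Let $\Bbbk$ be a field and let $\sigma_{inv}$ be the automorphism of $\Bbbk[h^{\pm 1}]$ with $\sigma_{inv}(h)=h^{-1}$. Every unit of the generalized Weyl algebra $\Bbbk[h^{\pm 1}](\sigma_{inv},1)$ is of the form $\alpha h^ix^j$ with $\alpha\in\Bbbk^*$ and $i,j\in\mathbb{Z}$.
   Context: For a $\Bbbk$-algebra $R$, a $\Bbbk$-algebra automorphism $\sigma$ of $R$ and a central element $a\in R$, the (degree-one) generalized Weyl algebra $R(\sigma,a)$ is the $\Bbbk$-algebra extension of $R$ generated by two indeterminates $x$ and $y$ subject to the relations $yx=a$, $xy=\sigma(a)$, $xr=\sigma(r)x$ and $yr=\sigma^{-1}(r)y$ for all $r\in R$. When $a=1$ one has $y=x^{-1}$, so $x^j$ makes sense for all $j\in\mathbb{Z}$. *)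

(* Defs.v *)
From HB Require Import structures.
From mathcomp Require Import all_boot all_order all_algebra.
From mathcomp Require Import finmap monalg generic_quotient boolp.

Set Implicit Arguments.
Unset Strict Implicit.
Unset Printing Implicit Defensive.

Import GRing.Theory.

Local Open Scope fset_scope.
Local Open Scope quotient_scope.
Local Open Scope ring_scope.

(* A unitRingType must decide invertibility and supply inverses; both are      *)
(* obtained here classically, so [x \is a GRing.unit] holds if and only if x   *)
(* has a two-sided inverse (see [GRing.unitrP]).                               *)
Section ClassicalInverse.
Variable R : nzRingType.
Implicit Types x y : R.

Definition has_inv x : Prop := exists y, y * x = 1 /\ x * y = 1.

Definition classical_unit : pred R := fun x => `[< has_inv x >].

Definition classical_inv x : R :=
  if pselect (has_inv x) is left e then projT1 (cid e) else x.

Lemma classical_mulVr :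
  {in classical_unit, left_inverse 1 classical_inv *%R}.
Proof.
move=> x /asboolP ex; rewrite /classical_inv.
by case: pselect => // e; case: cid => y [].
Qed.

Lemma classical_divrr :
  {in classical_unit, right_inverse 1 classical_inv *%R}.
Proof.
move=> x /asboolP ex; rewrite /classical_inv.
by case: pselect => // e; case: cid => y [].
Qed.

Lemma classical_unitrP x y : y * x = 1 /\ x * y = 1 -> classical_unit x.
Proof. by move=> xy; apply/asboolP; exists y. Qed.

Lemma classical_invr_out :
  {in [predC classical_unit], classical_inv =1 id}.
Proof.
move=> x /negP Nx; rewrite /classical_inv.
by case: pselect => // e; case: Nx; apply/asboolP.
Qed.

End ClassicalInverse.

(* Laurent polynomials: finitely supported functions int -> k, where           *)
(* << c *g n >> stands for c h^n, with the convolution product.  The ring      *)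
(* structure of [monalg] is not available because int is not a [monomType].    *)
Definition laurent (k : fieldType) : Type := {malg k[int]}.

Section Laurent.
Variable k : fieldType.
Implicit Types (p q : laurent k) (m n : int) (c : k).

HB.instance Definition _ := GRing.Lmodule.on (laurent k).

Definition laurent_one : laurent k := << 1 *g (0 : int) >>.

Definition laurent_mul p q : laurent k :=
  \sum_(m <- msupp p) \sum_(n <- msupp q) << p@_m * q@_n *g m + n >>.

Lemma laurent_mulw (d e : {fset int}) p q :
  msupp p `<=` d -> msupp q `<=` e ->
  laurent_mul p q = \sum_(m <- d) \sum_(n <- e) << p@_m * q@_n *g m + n >>.
Proof.
move=> led lee; rewrite /laurent_mul (big_fset_incl _ led) /=.
  apply/eq_bigr=> m _; apply/big_fset_incl => // n _ /mcoeff_outdom ->.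
  by rewrite mulr0 monalgU0.
move=> m _ /mcoeff_outdom pm.
by rewrite big1 => // n _; rewrite pm mul0r monalgU0.
Qed.

Lemma laurent_mulC : commutative laurent_mul.
Proof.
move=> p q; rewrite /laurent_mul exchange_big /=.
by apply: eq_bigr => n _; apply: eq_bigr => m _; rewrite mulrC addrC.
Qed.

Lemma laurent_mulDl : left_distributive laurent_mul +%R.
Proof.
move=> p q r.
rewrite (laurent_mulw (msuppD_le p q) (fsubset_refl (msupp r))).
rewrite (laurent_mulw (fsubsetUl (msupp p) (msupp q)) (fsubset_refl (msupp r))).
rewrite (laurent_mulw (fsubsetUr (msupp p) (msupp q)) (fsubset_refl (msupp r))).
rewrite -big_split /=; apply/eq_bigr=> m _.
rewrite -big_split /=; apply/eq_bigr=> n _.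
by rewrite mcoeffD mulrDl monalgUD.
Qed.

Lemma laurent_mulDr : right_distributive laurent_mul +%R.
Proof. by move=> r p q; rewrite !(laurent_mulC r) laurent_mulDl. Qed.

Lemma laurent_mul0l : left_zero 0 laurent_mul.
Proof. by move=> p; rewrite /laurent_mul msupp0 big_seq_fset0. Qed.

Lemma laurent_mul0r : right_zero 0 laurent_mul.
Proof. by move=> p; rewrite laurent_mulC laurent_mul0l. Qed.

Lemma laurent_mulUU c d m n :
  laurent_mul << c *g m >> << d *g n >> = << c * d *g m + n >>.
Proof. by rewrite (laurent_mulw msuppU_le msuppU_le) !big_seq_fset1 !mcoeffUU. Qed.

Lemma laurent_mul1l : left_id laurent_one laurent_mul.
Proof.
move=> p; rewrite (laurent_mulw msuppU_le (fsubset_refl _)) big_seq_fset1.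
rewrite [RHS]monalgE; apply: eq_bigr => n _.
by rewrite mcoeffUU mul1r add0r.
Qed.

Lemma laurent_ext (F G : laurent k -> laurent k) :
    F 0 = 0 -> {morph F : p q / p + q} -> G 0 = 0 -> {morph G : p q / p + q} ->
    (forall c n, F << c *g n >> = G << c *g n >>) ->
  F =1 G.
Proof.
move=> F0 FD G0 GD FG p; rewrite (monalgE p).
rewrite (big_morph F FD F0) (big_morph G GD G0).
by apply: eq_bigr => n _; apply: FG.
Qed.

Lemma laurent_mulA : associative laurent_mul.
Proof.
have l0 := laurent_mul0l; have r0 := laurent_mul0r.
have Dl := laurent_mulDl; have Dr := laurent_mulDr.
move=> p q r; move: p.
apply: laurent_ext => [|p p'||p p'|c l]; rewrite ?(l0, Dl) //.
move: q; apply: laurent_ext => [|q q'||q q'|d m]; rewrite ?(l0, r0, Dl, Dr) //.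
move: r; apply: laurent_ext => [|r r'||r r'|e n]; rewrite ?(r0, Dr) //.
by rewrite !laurent_mulUU mulrA addrA.
Qed.

Lemma laurent_one_neq0 : laurent_one != 0.
Proof. by rewrite monalgU_eq0 oner_eq0. Qed.

HB.instance Definition _ := GRing.Zmodule_isComNzRing.Build (laurent k)
  laurent_mulA laurent_mulC laurent_mul1l laurent_mulDl laurent_one_neq0.

Lemma laurent_scalerAl c p q : c *: (p * q) = (c *: p) * q.
Proof.
have Z r : c *: r = laurent_mul << c *g (0 : int) >> r.
  rewrite (laurent_mulw msuppU_le (fsubset_refl _)) big_seq_fset1.
  by rewrite malgZ_def; apply: eq_bigr => n _; rewrite mcoeffUU add0r.
by rewrite !Z; exact: (laurent_mulA _ p q).
Qed.

HB.instance Definition _ :=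
  GRing.Lmodule_isLalgebra.Build k (laurent k) laurent_scalerAl.
HB.instance Definition _ := GRing.Lalgebra_isComAlgebra.Build k (laurent k).

HB.instance Definition _ := GRing.NzRing_hasMulInverse.Build (laurent k)
  (@classical_mulVr (laurent k)) (@classical_divrr (laurent k))
  (@classical_unitrP (laurent k)) (@classical_invr_out (laurent k)).

Definition laurent_h : laurent k := << 1 *g (1 : int) >>.

Lemma laurentU_inv n : (<< 1 *g n >> : laurent k)^-1 = << 1 *g - n >>.
Proof.
have E : (<< 1 *g n >> : laurent k) * (<< 1 *g - n >> : laurent k) = 1.
  by rewrite [LHS]laurent_mulUU mul1r subrr.
have U : (<< 1 *g n >> : laurent k) \is a GRing.unit.
  by apply/unitrP; exists << 1 *g - n >>; split=> //; rewrite mulrC.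
by apply: (mulrI U); rewrite E mulrV.
Qed.

Lemma laurent_h_expz n : laurent_h ^ n = << 1 *g n >>.
Proof.
have N (m : nat) : laurent_h ^+ m = << 1 *g m%:Z >>.
  elim: m => [|m IHm] //.
  by rewrite exprS IHm [LHS]laurent_mulUU mul1r -intS.
case: n => m; first exact: N.
by rewrite /exprz N laurentU_inv NegzE.
Qed.

Definition laurent_inv_fun p : laurent k :=
  \sum_(n <- msupp p) << p@_n *g - n >>.

Lemma laurent_inv_funw (d : {fset int}) p : msupp p `<=` d ->
  laurent_inv_fun p = \sum_(n <- d) << p@_n *g - n >>.
Proof.
move=> led; apply/big_fset_incl => // n _ /mcoeff_outdom ->.
by rewrite monalgU0.
Qed.

Lemma laurent_inv_funE p n : (laurent_inv_fun p)@_n = p@_(- n).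
Proof.
rewrite raddf_sum /=; have [n_p|n_p] := boolP (- n \in msupp p).
  rewrite (big_fsetD1 (- n)) //= mcoeffU opprK eqxx mulr1n big1_fset ?addr0 //.
  move=> m; rewrite in_fsetD1 => /andP [mn _] _.
  by rewrite mcoeffU eqr_oppLR (negbTE mn).
rewrite (mcoeff_outdom n_p) big1_fset // => m m_p _.
by rewrite mcoeffU eqr_oppLR; case: eqP n_p => // <-; rewrite m_p.
Qed.

Lemma laurent_inv_is_linear : linear laurent_inv_fun.
Proof.
move=> c p q; apply/malgP => n.
by rewrite mcoeffD mcoeffZ !laurent_inv_funE mcoeffD mcoeffZ.
Qed.

HB.instance Definition _ :=
  GRing.isLinear.Build k (laurent k) (laurent k) *:%R laurent_inv_fun
    laurent_inv_is_linear.

Lemma laurent_inv_funU c n : laurent_inv_fun << c *g n >> = << c *g - n >>.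
Proof. by rewrite (laurent_inv_funw msuppU_le) big_seq_fset1 mcoeffUU. Qed.

Lemma laurent_inv_is_monoid_morphism : monoid_morphism laurent_inv_fun.
Proof.
split=> [|p q]; first by rewrite laurent_inv_funU oppr0.
rewrite (_ : p * q = laurent_mul p q) // /laurent_mul linear_sum /=.
rewrite [X in _ = X * _](_ : _ = \sum_(m <- msupp p) << p@_m *g - m >>) //.
rewrite mulr_suml; apply: eq_bigr => m _; rewrite linear_sum /= mulr_sumr.
apply: eq_bigr => n _; rewrite laurent_inv_funU opprD.
by rewrite -laurent_mulUU.
Qed.

HB.instance Definition _ :=
  GRing.isMonoidMorphism.Build (laurent k) (laurent k) laurent_inv_fun
    laurent_inv_is_monoid_morphism.

Lemma laurent_inv_funK : cancel laurent_inv_fun laurent_inv_fun.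
Proof. by move=> p; apply/malgP => n; rewrite !laurent_inv_funE opprK. Qed.

End Laurent.

Arguments laurent_h {k}.

Section Data.
Variables (k : fieldType) (R : algType k).

Record alg_automorphism := AlgAutomorphism {
  aut_map :> {lrmorphism R -> R};
  aut_inv : R -> R;
  aut_mapK : cancel aut_map aut_inv;
  aut_invK : cancel aut_inv aut_map
}.

Record central_element := CentralElement {
  central_val : R;
  central_comm : forall r, GRing.comm central_val r
}.

Definition central_one := CentralElement (fun r => commr_sym (commr1 r)).

End Data.

Arguments central_one {k R}.

Definition sigma_inv (k : fieldType) : alg_automorphism (laurent k) :=
  @AlgAutomorphism k (laurent k) (@laurent_inv_fun k) (@laurent_inv_fun k)
    (@laurent_inv_funK k) (@laurent_inv_funK k).

Lemma sigma_inv_h (k : fieldType) : sigma_inv k laurent_h = laurent_h^-1.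
Proof. by rewrite /= laurent_inv_funU laurentU_inv. Qed.

(* R(sigma, a) is presented literally: ring expressions in x, y and the        *)
(* elements of R, modulo the smallest congruence that contains the ring        *)
(* axioms, the identities of R and the defining relations.                     *)
Section GWA.
Variables (k : fieldType) (R : algType k).
Variables (sigma : alg_automorphism R) (a : central_element R).

Inductive gwa_term : Type :=
  | TConst of R
  | TX
  | TY
  | TAdd of gwa_term & gwa_term
  | TOpp of gwa_term
  | TMul of gwa_term & gwa_term.

Inductive gwa_eq : gwa_term -> gwa_term -> Prop :=
  | GwaRefl t : gwa_eq t t
  | GwaSym t u : gwa_eq t u -> gwa_eq u t
  | GwaTrans t u v : gwa_eq t u -> gwa_eq u v -> gwa_eq t v
  | GwaAdd t t' u u' :
      gwa_eq t t' -> gwa_eq u u' -> gwa_eq (TAdd t u) (TAdd t' u')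
  | GwaOpp t t' : gwa_eq t t' -> gwa_eq (TOpp t) (TOpp t')
  | GwaMul t t' u u' :
      gwa_eq t t' -> gwa_eq u u' -> gwa_eq (TMul t u) (TMul t' u')
  | GwaAddA t u v : gwa_eq (TAdd t (TAdd u v)) (TAdd (TAdd t u) v)
  | GwaAddC t u : gwa_eq (TAdd t u) (TAdd u t)
  | GwaAdd0 t : gwa_eq (TAdd (TConst 0) t) t
  | GwaAddN t : gwa_eq (TAdd (TOpp t) t) (TConst 0)
  | GwaMulA t u v : gwa_eq (TMul t (TMul u v)) (TMul (TMul t u) v)
  | GwaMul1l t : gwa_eq (TMul (TConst 1) t) t
  | GwaMul1r t : gwa_eq (TMul t (TConst 1)) t
  | GwaMulDl t u v : gwa_eq (TMul (TAdd t u) v) (TAdd (TMul t v) (TMul u v))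
  | GwaMulDr t u v : gwa_eq (TMul t (TAdd u v)) (TAdd (TMul t u) (TMul t v))
  | GwaConstD r s : gwa_eq (TConst (r + s)) (TAdd (TConst r) (TConst s))
  | GwaConstM r s : gwa_eq (TConst (r * s)) (TMul (TConst r) (TConst s))
  | GwaYX : gwa_eq (TMul TY TX) (TConst (central_val a))
  | GwaXY : gwa_eq (TMul TX TY) (TConst (sigma (central_val a)))
  | GwaXr r : gwa_eq (TMul TX (TConst r)) (TMul (TConst (sigma r)) TX)
  | GwaYr r : gwa_eq (TMul TY (TConst r)) (TMul (TConst (aut_inv sigma r)) TY).

HB.instance Definition _ := gen_eqMixin gwa_term.
HB.instance Definition _ := gen_choiceMixin gwa_term.

Definition gwa_eqb : rel gwa_term := fun t u => `[< gwa_eq t u >].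

Lemma gwa_eqb_refl : reflexive gwa_eqb.
Proof. by move=> t; apply/asboolP; apply: GwaRefl. Qed.

Lemma gwa_eqb_sym : symmetric gwa_eqb.
Proof. by move=> t u; apply/asboolP/asboolP; apply: GwaSym. Qed.

Lemma gwa_eqb_trans : transitive gwa_eqb.
Proof.
by move=> u t v /asboolP tu /asboolP uv; apply/asboolP; apply: GwaTrans uv.
Qed.

Canonical gwa_equiv := EquivRel gwa_eqb gwa_eqb_refl gwa_eqb_sym gwa_eqb_trans.

Definition gwa : Type := {eq_quot gwa_equiv}.

HB.instance Definition _ := Choice.on gwa.
HB.instance Definition _ := Quotient.on gwa.

Definition gwa_class (t : gwa_term) : gwa := \pi_gwa t.

Lemma gwa_classP t u : gwa_class t = gwa_class u <-> gwa_eq t u.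
Proof.
split=> [/(@eqmodP _ gwa_equiv)|tu]; first exact: asboolW.
by apply/(@eqmodP _ gwa_equiv)/asboolP.
Qed.

Lemma gwa_repr_eq t : gwa_eq (repr (gwa_class t)) t.
Proof. by apply/gwa_classP; rewrite /gwa_class reprK. Qed.

Lemma gwa_class_ind (P : gwa -> Prop) :
  (forall t, P (gwa_class t)) -> forall u, P u.
Proof. by move=> Pc u; rewrite -[u]reprK; apply: Pc. Qed.

Definition gwa_add (u v : gwa) : gwa := gwa_class (TAdd (repr u) (repr v)).
Definition gwa_opp (u : gwa) : gwa := gwa_class (TOpp (repr u)).
Definition gwa_mul (u v : gwa) : gwa := gwa_class (TMul (repr u) (repr v)).
Definition gwa_scale (c : k) (u : gwa) : gwa :=
  gwa_class (TMul (TConst c%:A) (repr u)).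

Lemma gwa_addE t u : gwa_add (gwa_class t) (gwa_class u) = gwa_class (TAdd t u).
Proof. by apply/gwa_classP; apply: GwaAdd; apply: gwa_repr_eq. Qed.

Lemma gwa_oppE t : gwa_opp (gwa_class t) = gwa_class (TOpp t).
Proof. by apply/gwa_classP; apply: GwaOpp; apply: gwa_repr_eq. Qed.

Lemma gwa_mulE t u : gwa_mul (gwa_class t) (gwa_class u) = gwa_class (TMul t u).
Proof. by apply/gwa_classP; apply: GwaMul; apply: gwa_repr_eq. Qed.

Lemma gwa_addA : associative gwa_add.
Proof.
elim/gwa_class_ind=> t; elim/gwa_class_ind=> u; elim/gwa_class_ind=> v.
by rewrite !gwa_addE; apply/gwa_classP/GwaAddA.
Qed.

Lemma gwa_addC : commutative gwa_add.
Proof.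
elim/gwa_class_ind=> t; elim/gwa_class_ind=> u.
by rewrite !gwa_addE; apply/gwa_classP/GwaAddC.
Qed.

Lemma gwa_add0 : left_id (gwa_class (TConst 0)) gwa_add.
Proof. by elim/gwa_class_ind=> t; rewrite gwa_addE; apply/gwa_classP/GwaAdd0. Qed.

Lemma gwa_addN : left_inverse (gwa_class (TConst 0)) gwa_opp gwa_add.
Proof.
by elim/gwa_class_ind=> t; rewrite gwa_oppE gwa_addE; apply/gwa_classP/GwaAddN.
Qed.

HB.instance Definition _ :=
  GRing.isZmodule.Build gwa gwa_addA gwa_addC gwa_add0 gwa_addN.

Lemma gwa_mulA : associative gwa_mul.
Proof.
elim/gwa_class_ind=> t; elim/gwa_class_ind=> u; elim/gwa_class_ind=> v.
by rewrite !gwa_mulE; apply/gwa_classP/GwaMulA.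
Qed.

Lemma gwa_mul1l : left_id (gwa_class (TConst 1)) gwa_mul.
Proof.
by elim/gwa_class_ind=> t; rewrite gwa_mulE; apply/gwa_classP/GwaMul1l.
Qed.

Lemma gwa_mul1r : right_id (gwa_class (TConst 1)) gwa_mul.
Proof.
by elim/gwa_class_ind=> t; rewrite gwa_mulE; apply/gwa_classP/GwaMul1r.
Qed.

Lemma gwa_mulDl : left_distributive gwa_mul gwa_add.
Proof.
elim/gwa_class_ind=> t; elim/gwa_class_ind=> u; elim/gwa_class_ind=> v.
by rewrite !(gwa_addE, gwa_mulE); apply/gwa_classP/GwaMulDl.
Qed.

Lemma gwa_mulDr : right_distributive gwa_mul gwa_add.
Proof.
elim/gwa_class_ind=> t; elim/gwa_class_ind=> u; elim/gwa_class_ind=> v.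
by rewrite !(gwa_addE, gwa_mulE); apply/gwa_classP/GwaMulDr.
Qed.

(* To see that 1 != 0, let R(sigma, a) act on the functions f : int -> R by    *)
(* (r f)(n) = sigma^n(r) f(n), (x f)(n) = f(n + 1) and                         *)
(* (y f)(n) = sigma^n(a) f(n - 1).                                             *)
Definition autz (n : int) : R -> R :=
  match n with
  | Posz m => iter m sigma
  | Negz m => iter m.+1 (aut_inv sigma)
  end.

Lemma autz_morph (n : int) :
  [/\ autz n 0 = 0, autz n 1 = 1, {morph autz n : r s / r + s}
    & {morph autz n : r s / r * s}].
Proof.
have invI := can_inj (aut_mapK sigma).
case: n => m /=; last rewrite -!iterS.
  elim: m => [|m [I0 I1 ID IM]] //=; split=> [||r s|r s] /=.
  - by rewrite I0 rmorph0.
  - by rewrite I1 rmorph1.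
  - by rewrite ID rmorphD.
  - by rewrite IM rmorphM.
have [z o d p] : [/\ aut_inv sigma 0 = 0, aut_inv sigma 1 = 1,
    {morph aut_inv sigma : r s / r + s} & {morph aut_inv sigma : r s / r * s}].
  split=> [||r s|r s]; apply: invI.
  - by rewrite aut_invK rmorph0.
  - by rewrite aut_invK rmorph1.
  - by rewrite aut_invK rmorphD /= !aut_invK.
  - by rewrite aut_invK rmorphM /= !aut_invK.
have H j : [/\ iter j (aut_inv sigma) 0 = 0, iter j (aut_inv sigma) 1 = 1,
    {morph iter j (aut_inv sigma) : r s / r + s}
    & {morph iter j (aut_inv sigma) : r s / r * s}].
  elim: j => [|j [I0 I1 ID IM]] //=; split=> [||r s|r s] /=.
  - by rewrite I0.
  - by rewrite I1.
  - by rewrite ID.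
  - by rewrite IM.
exact: (H m.+1).
Qed.

Lemma autzS (n : int) (r : R) : autz (n + 1) r = autz n (sigma r).
Proof.
case: n => m; first by rewrite -PoszD addn1 /autz iterSr.
rewrite NegzE -addn1 PoszD opprD subrK; case: m => [|m] /=.
  by rewrite aut_mapK.
by rewrite addn0 -!iterS [in RHS]iterSr aut_mapK.
Qed.

Lemma autzB (n : int) (r : R) : autz (n - 1) r = autz n (aut_inv sigma r).
Proof. by rewrite -[n in RHS](subrK 1) autzS aut_invK. Qed.

Lemma autz_sigma_comm (n : int) (r : R) : GRing.comm (autz n (central_val a)) (autz n r).
Proof.
by have [_ _ _ M] := autz_morph n; rewrite /GRing.comm -!M central_comm.
Qed.

Fixpoint gwa_act (t : gwa_term) (f : int -> R) (n : int) : R :=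
  match t with
  | TConst r => autz n r * f n
  | TX => f (n + 1)
  | TY => autz n (central_val a) * f (n - 1)
  | TAdd t u => gwa_act t f n + gwa_act u f n
  | TOpp t => - gwa_act t f n
  | TMul t u => gwa_act t (gwa_act u f) n
  end.

Lemma gwa_actD t (f g : int -> R) n :
  gwa_act t (fun m => f m + g m) n = gwa_act t f n + gwa_act t g n.
Proof.
elim: t f g n => [r|||t IHt u IHu|t IHt|t IHt u IHu] f g n //=.
- by rewrite mulrDr.
- by rewrite mulrDr.
- by rewrite IHt IHu addrACA.
- by rewrite IHt opprD.
- by rewrite -IHt; congr (gwa_act t _ n); apply/funext => m; rewrite IHu.
Qed.

Lemma gwa_act_eq t u : gwa_eq t u -> gwa_act t = gwa_act u.
Proof.
elim=> {t u} [t|t u _ ->|t u v _ -> _ ->|t t' u u' _ /= IH1 _ IH2|t t' _ /= IH|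
  t t' u u' _ /= IH1 _ IH2|t u v|t u|t|t|t u v|t|t|t u v|t u v|r s|r s|||r|r] //=;
  apply/funext => f; apply/funext => n /=.
- by rewrite IH1 IH2.
- by rewrite IH.
- by rewrite IH1 IH2.
- by rewrite addrA.
- by rewrite addrC.
- by have [-> _ _ _] := autz_morph n; rewrite mul0r add0r.
- by have [-> _ _ _] := autz_morph n; rewrite mul0r addNr.
- by have [_ -> _ _] := autz_morph n; rewrite mul1r.
- congr (gwa_act t _ n); apply/funext => m.
  by have [_ -> _ _] := autz_morph m; rewrite mul1r.
- by rewrite -gwa_actD.
- by have [_ _ -> _] := autz_morph n; rewrite mulrDl.
- by have [_ _ _ ->] := autz_morph n; rewrite mulrA.
- by rewrite subrK.
- by rewrite addrK autzS.
- by rewrite autzS.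
- by rewrite !mulrA autzB autz_sigma_comm.
Qed.

Lemma gwa_one_neq0 : gwa_class (TConst 1) != 0.
Proof.
apply/eqP => /gwa_classP /gwa_act_eq /(congr1 (fun F => F (fun=> 1) 0)) /=.
by rewrite mul1r mul0r; apply/eqP/oner_neq0.
Qed.

HB.instance Definition _ := GRing.Zmodule_isNzRing.Build gwa
  gwa_mulA gwa_mul1l gwa_mul1r gwa_mulDl gwa_mulDr gwa_one_neq0.

Definition gwa_const (r : R) : gwa := gwa_class (TConst r).
Definition gwa_x : gwa := gwa_class TX.
Definition gwa_y : gwa := gwa_class TY.

Lemma gwa_constD : {morph gwa_const : r s / r + s}.
Proof. by move=> r s; rewrite [RHS]gwa_addE; apply/gwa_classP/GwaConstD. Qed.

Lemma gwa_constM : {morph gwa_const : r s / r * s}.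
Proof. by move=> r s; rewrite [RHS]gwa_mulE; apply/gwa_classP/GwaConstM. Qed.

Lemma gwa_yx : gwa_y * gwa_x = gwa_const (central_val a).
Proof. by rewrite [LHS]gwa_mulE; apply/gwa_classP/GwaYX. Qed.

Lemma gwa_xy : gwa_x * gwa_y = gwa_const (sigma (central_val a)).
Proof. by rewrite [LHS]gwa_mulE; apply/gwa_classP/GwaXY. Qed.

Lemma gwa_xr r : gwa_x * gwa_const r = gwa_const (sigma r) * gwa_x.
Proof. by rewrite [LHS]gwa_mulE [RHS]gwa_mulE; apply/gwa_classP/GwaXr. Qed.

Lemma gwa_yr r : gwa_y * gwa_const r = gwa_const (aut_inv sigma r) * gwa_y.
Proof. by rewrite [LHS]gwa_mulE [RHS]gwa_mulE; apply/gwa_classP/GwaYr. Qed.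

Lemma gwa_gen_ind (P : gwa -> Prop) :
    (forall r, P (gwa_const r)) -> P gwa_x -> P gwa_y ->
    (forall u v, P u -> P v -> P (u + v)) ->
    (forall u v, P u -> P v -> P (u * v)) ->
  forall u, P u.
Proof.
move=> Pr Px Py PD PM; elim/gwa_class_ind.
elim=> [r|||t IHt u IHu|t IHt|t IHt u IHu] //.
- exact: Pr.
- by rewrite -gwa_addE; apply: PD.
- rewrite -gwa_oppE -[gwa_opp _]/(- gwa_class t) -mulN1r; apply: (PM _ _ _ IHt).
  suff -> : -1 = gwa_const (-1) by [].
  by apply/esym/eqP; rewrite -addr_eq0 -(gwa_constD (-1) 1) addNr.
- by rewrite -gwa_mulE; apply: PM.
Qed.

Lemma gwa_scaleE c u : gwa_scale c u = gwa_const c%:A * u.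
Proof. by rewrite -[u]reprK [RHS]gwa_mulE reprK. Qed.

Lemma gwa_const_scal_comm (c : k) u : GRing.comm (gwa_const c%:A) u.
Proof.
elim/gwa_gen_ind: u => [r||| u v|u v].
- by rewrite /GRing.comm -!gwa_constM mulr_algl mulr_algr.
- by rewrite /GRing.comm gwa_xr linearZ /= rmorph1.
- rewrite /GRing.comm gwa_yr; congr (gwa_const _ * _).
  by apply: (can_inj (aut_mapK sigma)); rewrite aut_invK linearZ /= rmorph1.
- exact: commrD.
- exact: commrM.
Qed.

Lemma gwa_scalerA c d u : gwa_scale c (gwa_scale d u) = gwa_scale (c * d) u.
Proof. by rewrite !gwa_scaleE mulrA -gwa_constM mulr_algl scalerA. Qed.

Lemma gwa_scale1r : left_id 1 gwa_scale.
Proof. by move=> u; rewrite gwa_scaleE scale1r mul1r. Qed.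

Lemma gwa_scalerDr : right_distributive gwa_scale +%R.
Proof. by move=> c u v; rewrite !gwa_scaleE mulrDr. Qed.

Lemma gwa_scalerDl u : {morph gwa_scale^~ u : c d / c + d}.
Proof. by move=> c d; rewrite !gwa_scaleE scalerDl gwa_constD mulrDl. Qed.

HB.instance Definition _ := GRing.Zmodule_isLmodule.Build k gwa
  gwa_scalerA gwa_scale1r gwa_scalerDr gwa_scalerDl.

Lemma gwa_scalerAl (c : k) (u v : gwa) : c *: (u * v) = (c *: u) * v.
Proof.
by rewrite -[LHS]/(gwa_scale _ _) -[c *: u]/(gwa_scale _ _) !gwa_scaleE mulrA.
Qed.

HB.instance Definition _ := GRing.Lmodule_isLalgebra.Build k gwa gwa_scalerAl.

Lemma gwa_scalerAr (c : k) (u v : gwa) : c *: (u * v) = u * (c *: v).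
Proof.
rewrite -[LHS]/(gwa_scale _ _) -[c *: v]/(gwa_scale _ _) !gwa_scaleE !mulrA.
by rewrite gwa_const_scal_comm.
Qed.

HB.instance Definition _ := GRing.Lalgebra_isAlgebra.Build k gwa gwa_scalerAr.

HB.instance Definition _ := GRing.NzRing_hasMulInverse.Build gwa
  (@classical_mulVr gwa) (@classical_divrr gwa)
  (@classical_unitrP gwa) (@classical_invr_out gwa).

Lemma gwa_const_is_linear : linear gwa_const.
Proof.
move=> c r s; rewrite gwa_constD -[c *: gwa_const r]/(gwa_scale _ _) gwa_scaleE.
by rewrite -gwa_constM mulr_algl.
Qed.

HB.instance Definition _ :=
  GRing.isLinear.Build k R gwa *:%R gwa_const gwa_const_is_linear.

Lemma gwa_const_is_monoid_morphism : monoid_morphism gwa_const.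
Proof. by split=> // r s; rewrite gwa_constM. Qed.

HB.instance Definition _ :=
  GRing.isMonoidMorphism.Build R gwa gwa_const gwa_const_is_monoid_morphism.

End GWA.

Arguments gwa {k R} sigma a.
Arguments gwa_const {k R} sigma a r.
Arguments gwa_x {k R sigma a}.
Arguments gwa_y {k R sigma a}.

Lemma gwa_x_inv (k : fieldType) (R : algType k) (sigma : alg_automorphism R) :
  (gwa_x : gwa sigma central_one)^-1 = gwa_y.
Proof.
have xy : (gwa_x : gwa sigma central_one) * gwa_y = 1.
  by rewrite gwa_xy rmorph1.
have yx : (gwa_y : gwa sigma central_one) * gwa_x = 1 by rewrite gwa_yx.
have U : (gwa_x : gwa sigma central_one) \is a GRing.unit.
  by apply/unitrP; exists gwa_y.
by apply: (mulrI U); rewrite xy mulrV.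
Qed.

(* Main.v *)
Require Import Defs.
From mathcomp Require Import all_boot all_order all_algebra.
From mathcomp Require Import finmap monalg boolp zify.

Import GRing.Theory.
Local Open Scope ring_scope.

(** Both k[h^{+-1}] and k[h^{+-1}][x^{+-1}; sigma] are Z-graded.  If the
    coefficients have no zero divisors, then the terms of lowest degree of two
    nonzero factors multiply to a nonzero term, and so do those of highest
    degree.  Hence k[h^{+-1}] is a domain, and in both rings a product that is
    concentrated in degree 0 has factors concentrated in one degree each.  The
    uniqueness of the x-expansion comes from the action of the algebra on the
    functions int -> R. *)

(** * Extremal terms of convolutions indexed by the integers *)

Lemma malg_exists_max {G : zmodType} (g : {malg G[int]}) (e : int) : g != 0 ->
  exists2 m, m \in msupp g & forall n, n \in msupp g -> e * n <= e * m.
Proof.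
move=> g0; have [m0 m0g] : exists m, m \in msupp g.
  by apply/fset0Pn; apply: contraNneq g0 => g0; rewrite [g]monalgE g0 big_seq_fset0.
have [m _ max_m] := @Order.TotalTheory.arg_maxP _ _ _ [` m0g]%fset predT
  (fun m : msupp g => e * val m) erefl.
exists (val m) => [|n n_g]; first exact: valP.
exact: (max_m [` n_g]%fset).
Qed.

Section Convolution.
Variables (D E V : zmodType) (p : {malg D[int]}) (q : {malg E[int]}).
Variable F : int -> int -> V.
Hypothesis F0 : forall m n, F m n = 0 <-> p@_m = 0 \/ q@_n = 0.

(* [F m n] stands for the product of the components of degree m and n; [e = 1]
   picks out the terms of highest degree and [e = -1] those of lowest degree. *)
Lemma conv_extremal (e : int) : e != 0 -> p != 0 -> q != 0 ->
  exists2 MN : int * int,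
    (forall m, m \in msupp p -> e * m <= e * MN.1) /\
    (forall n, n \in msupp q -> e * n <= e * MN.2)
  & \sum_(m <- msupp p) F m (MN.1 + MN.2 - m) != 0.
Proof.
move=> e0 /(malg_exists_max _ e)[M Mp maxM] /(malg_exists_max _ e)[N Nq maxN].
exists (M, N) => //=; rewrite (big_fsetD1 M) //= [M + N]addrC addrK.
rewrite big1_fset => [|m].
  rewrite addr0; apply/eqP => /F0[] /eqP.
    by rewrite mcoeff_eq0 Mp.
  by rewrite mcoeff_eq0 Nq.
(* For [m] other than [M], [e * m < e * M], so the partner degree [M + N - m] lies beyond [N] in
   direction [e], outside the support of [q]. *)
rewrite in_fsetD1 => /andP[mM mp] _; apply/F0; right; apply/mcoeff_outdom.
apply/negP => /maxN; have := maxM _ mp; move: e0 mM; nia.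
Qed.

(** The top degrees and the bottom degrees of the two factors both add up to 0. As [M' <= M] and
    [N' <= N], this forces [M = M']. *)
Lemma conv_concentrated : p != 0 -> q != 0 ->
    (forall n, n != 0 -> \sum_(m <- msupp p) F m (n - m) = 0) ->
  exists2 M, msupp p = [fset M]%fset
    & \sum_(m <- msupp p) F m (0 - m) = F M (- M).
Proof.
move=> p0 q0 conv0.
have sum0 M N : \sum_(m <- msupp p) F m (M + N - m) != 0 -> M + N = 0.
  by move=> nz; apply/eqP; apply: contraNT nz => /conv0 ->.
have [//|[M N] /= [maxM maxN] /(sum0 M N) MN] := @conv_extremal 1 _ p0 q0.
have [//|[M' N'] /= [minM minN] /(sum0 M' N') MN'] := @conv_extremal (-1) _ p0 q0.
have [m0 m0p _] := malg_exists_max _ 1 p0.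
have [n0 n0q _] := malg_exists_max _ 1 q0.
have pM : msupp p = [fset M]%fset.
  have eqM m : m \in msupp p -> m = M.
    move=> mp; move: (maxM _ mp) (minM _ mp) (maxN _ n0q) (minN _ n0q) MN MN'.
    by lia.
  apply/fsetP => m; rewrite in_fset1; apply/idP/eqP => [/eqM //|->].
  by rewrite -(eqM _ m0p).
by exists M; rewrite // pM big_seq_fset1 sub0r.
Qed.

End Convolution.

Arguments conv_extremal {D E V p q F}.
Arguments conv_concentrated {D E V p q F}.

(** * Units of the Laurent polynomial ring *)

Section LaurentUnits.
Variable k : fieldType.
Implicit Types p q : laurent k.

Lemma laurent_mulE p q n :
  (p * q)@_n = \sum_(m <- msupp p) p@_m * q@_(n - m).
Proof.
rewrite [p * q](_ : _ = laurent_mul p q) // raddf_sum /=.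
apply: eq_bigr => m _; rewrite raddf_sum /=.
have nE i : (m + i == n) = (i == n - m) by rewrite eq_sym addrC -subr_eq eq_sym.
have [nq|nq] := boolP (n - m \in msupp q).
  rewrite (big_fsetD1 (n - m)) //= mcoeffU nE eqxx mulr1n big1_fset ?addr0 //.
  move=> i; rewrite in_fsetD1 => /andP[/negPf ni _] _.
  by rewrite mcoeffU nE ni.
rewrite (mcoeff_outdom nq) mulr0 big1_fset // => i iq _.
by rewrite mcoeffU nE; case: eqP iq nq => // -> ->.
Qed.

Lemma laurent_coef_mul0 p q m n :
  p@_m * q@_n = 0 <-> p@_m = 0 \/ q@_n = 0.
Proof.
split=> [/eqP|[]->]; rewrite ?mul0r ?mulr0 // mulf_eq0.
by case/orP => /eqP; [left|right].
Qed.

Lemma laurent_mulf_eq0 p q : p * q = 0 -> p = 0 \/ q = 0.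
Proof.
move=> pq0; have [->|p0] := eqVneq p 0; first by left.
right; apply/eqP; apply: contra_eqT pq0 => q0.
have [//|[M N] _ nz] := conv_extremal (laurent_coef_mul0 p q) 1 _ p0 q0.
by apply: contraNneq nz => pq0; rewrite -laurent_mulE pq0 mcoeff0.
Qed.

Lemma laurent_unitP p q : p * q = 1 ->
  exists2 c : k, c != 0 & exists i, p = c *: laurent_h ^ i.
Proof.
move=> pq1.
have p0 : p != 0.
  by apply: contra_eq_neq pq1 => ->; rewrite mul0r eq_sym oner_eq0.
have q0 : q != 0.
  by apply: contra_eq_neq pq1 => ->; rewrite mulr0 eq_sym oner_eq0.
have [n n0|M pM _] := conv_concentrated (laurent_coef_mul0 p q) p0 q0.
  rewrite -laurent_mulE pq1 [1](_ : _ = << 1 *g (0 : int) >>) //.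
  by rewrite mcoeffU eq_sym (negPf n0).
exists p@_M; first by rewrite mcoeff_neq0 pM in_fset1.
exists M; rewrite laurent_h_expz; apply/malgP => n.
by rewrite {1}[p]monalgE pM big_seq_fset1 mcoeffZ !mcoeffU mulr_natr.
Qed.

End LaurentUnits.

(** * Expansions in powers of [x], and units, when [a = 1] *)

Section GwaOne.
Variables (k : fieldType) (R : algType k) (sigma : alg_automorphism R).
Local Notation A := (gwa sigma central_one).
Local Notation const := (gwa_const sigma central_one).
Implicit Types (u v : A) (r : R) (f : int -> R) (g : {malg R[int]}) (n : int).

Lemma autz_eq0 n r : autz sigma n r = 0 <-> r = 0.
Proof.
split=> [|->]; last by case: (autz_morph sigma n).
have inj := can_inj (aut_mapK sigma).
elim/int_ind: n r => [//|n IHn|n IHn] r.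
  by rewrite -addn1 PoszD autzS => /IHn r0; apply: inj; rewrite rmorph0.
rewrite -addn1 PoszD opprD autzB => /IHn r0.
by rewrite -[r](aut_invK sigma) r0 rmorph0.
Qed.

Lemma gwa_x_unit : (gwa_x : A) \is a GRing.unit.
Proof.
by apply/unitrP; exists gwa_y; rewrite gwa_yx gwa_xy; split; rewrite // rmorph1.
Qed.

Definition gwa_expand g : A := mmap const (fun j => gwa_x ^ j) g.

Lemma gwa_expandU r n : gwa_expand << r *g n >> = const r * gwa_x ^ n.
Proof. exact: mmapU. Qed.

(** Left multiplication by each generator maps expansions to expansions, hence so does
    multiplication by [u]; applied to 1, this expands [u] itself. *)
Lemma gwa_expand_surj u : exists g, u = gwa_expand g.
Proof.
suff mulP : forall g, exists g', u * gwa_expand g = gwa_expand g'.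
  have [g ug] := mulP << 1 *g 0 >>; exists g.
  by rewrite -ug gwa_expandU rmorph1 !mulr1.
have ext u' :
    (forall r n, exists g', u' * (const r * gwa_x ^ n) = gwa_expand g') ->
    forall g, exists g', u' * gwa_expand g = gwa_expand g'.
  move=> mulU g; rewrite /gwa_expand mmapE mulr_sumr.
  elim/big_rec: _ => [|j w _ [g' ->]]; first by exists 0; rewrite mmap0.
  by have [g2 ->] := mulU g@_j j; exists (g2 + g'); rewrite /gwa_expand mmapD.
elim/gwa_gen_ind: u => [s||| u v IHu IHv|u v IHu IHv] g.
- apply: ext => r n; exists << s * r *g n >>.
  by rewrite gwa_expandU rmorphM mulrA.
- apply: ext => r n; exists << sigma r *g 1 + n >>.
  by rewrite gwa_expandU exprzDr ?gwa_x_unit // !mulrA gwa_xr.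
- apply: ext => r n; exists << aut_inv sigma r *g -1 + n >>.
  rewrite gwa_expandU exprzDr ?gwa_x_unit // !mulrA gwa_yr.
  by rewrite -[gwa_x ^ (-1)]/(gwa_x^-1) gwa_x_inv.
- have [[gu ug] [gv vg]] := (IHu g, IHv g).
  by exists (gu + gv); rewrite mulrDl ug vg /gwa_expand mmapD.
- by have [gv vg] := IHv g; rewrite -mulrA vg; apply: IHu.
Qed.

Definition gwa_rep u : (int -> R) -> int -> R :=
  gwa_act sigma central_one (repr u).

Lemma gwa_rep_class t :
  gwa_rep (gwa_class sigma central_one t) = gwa_act sigma central_one t.
Proof. exact/gwa_act_eq/gwa_repr_eq. Qed.

Lemma gwa_repD u v f n : gwa_rep (u + v) f n = gwa_rep u f n + gwa_rep v f n.
Proof. by rewrite -[u + v]/(gwa_add _ _) gwa_rep_class. Qed.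

Lemma gwa_repM u v f : gwa_rep (u * v) f = gwa_rep u (gwa_rep v f).
Proof. by rewrite -[u * v]/(gwa_mul _ _) gwa_rep_class. Qed.

Lemma gwa_rep_const r f n : gwa_rep (const r) f n = autz sigma n r * f n.
Proof. by rewrite gwa_rep_class. Qed.

Lemma gwa_rep1 f n : gwa_rep 1 f n = f n.
Proof.
rewrite -[1]/(const 1) gwa_rep_const.
by have [_ -> _ _] := autz_morph sigma n; rewrite mul1r.
Qed.

Lemma gwa_rep_xz (j : int) f n : gwa_rep (gwa_x ^ j) f n = f (n + j).
Proof.
elim/int_ind: j f n => [|j IHj|j IHj] f n.
- by rewrite gwa_rep1 addr0.
- rewrite -addn1 PoszD exprzDr ?gwa_x_unit // gwa_repM IHj.
  by rewrite gwa_rep_class /= addrA.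
- rewrite -addn1 PoszD opprD exprzDr ?gwa_x_unit // gwa_repM IHj.
  rewrite -[gwa_x ^ (-1)]/(gwa_x^-1) gwa_x_inv gwa_rep_class /= addrA.
  by have [_ -> _ _] := autz_morph sigma (n - j%:Z); rewrite mul1r.
Qed.

Lemma gwa_rep_expand g f n :
  gwa_rep (gwa_expand g) f n =
  \sum_(j <- msupp g) autz sigma n g@_j * f (n + j).
Proof.
have rep0 : gwa_rep 0 f n = 0.
  by apply: (addrI (gwa_rep 0 f n)); rewrite -gwa_repD !addr0.
rewrite /gwa_expand mmapE.
rewrite (big_morph (fun u => gwa_rep u f n) (fun u v => gwa_repD u v f n) rep0).
by apply: eq_bigr => j _; rewrite gwa_repM gwa_rep_const gwa_rep_xz.
Qed.

Definition dirac n : R := (n == 0)%:R.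

(** Only the term with [j = - n] survives. Since [autz sigma n] is injective, the action on [dirac]
    recovers every coefficient of an expansion. *)
Lemma gwa_rep_expand_dirac g n :
  gwa_rep (gwa_expand g) dirac n = autz sigma n g@_(- n).
Proof.
rewrite gwa_rep_expand /dirac.
have eqN (j : int) : (n + j == 0) = (j == - n) by rewrite addrC addr_eq0.
have [ng|ng] := boolP (- n \in msupp g).
  rewrite (big_fsetD1 (- n)) //= eqN eqxx mulr1 big1_fset ?addr0 // => j.
  by rewrite in_fsetD1 => /andP[/negPf nj _] _; rewrite eqN nj mulr0.
rewrite (mcoeff_outdom ng) big1_fset => [|j jg _].
  by have [-> _ _ _] := autz_morph sigma n.
by rewrite eqN; case: eqP jg ng => [->->|_ _ _] //; rewrite mulr0.
Qed.

Lemma gwa_one_unitP u :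
    (forall r s, r * s = 0 -> r = 0 \/ s = 0) ->
    u \is a GRing.unit ->
  exists r s (j : int), r * s = 1 /\ u = const r * gwa_x ^ j.
Proof.
move=> Rdom /unitrP[v [_]].
have [g ->] := gwa_expand_surj u; have [h ->] := gwa_expand_surj v => gh1.
have e0 : gwa_expand 0 = 0 by exact: mmap0.
have nz a b : gwa_expand a * gwa_expand b = 1 -> a != 0 /\ b != 0.
  move=> ab1; split; apply: contra_eq_neq ab1 => ->;
    by rewrite e0 ?mul0r ?mulr0 eq_sym oner_eq0.
have [g0 h0] := nz _ _ gh1.
(* Both sides of [u * v = 1] act on [dirac] and are evaluated at [- n], which reads off the
   coefficient of degree [n]. *)
have coef n : \sum_(m <- msupp g)
    autz sigma (- n) g@_m * autz sigma (- n + m) h@_(n - m) = dirac (- n).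
  rewrite -gwa_rep1 -gh1 gwa_repM gwa_rep_expand; apply: eq_bigr => m _.
  by rewrite gwa_rep_expand_dirac opprD opprK.
(* The coefficient [g@_m * sigma^m(h@_n)] of the product of two terms, with [sigma^(-(m+n))] applied
   to it. This vanishes only if [g@_m] or [h@_n] does, as [Rdom] holds and powers of [sigma] are
   injective. *)
pose F m n := autz sigma (- (m + n)) g@_m * autz sigma (- n) h@_n.
have F0 m n : F m n = 0 <-> g@_m = 0 \/ h@_n = 0.
  split=> [/Rdom[]/autz_eq0|[|] c0]; [by left|by right| |].
    by rewrite /F c0 (proj2 (autz_eq0 _ 0)) // mul0r.
  by rewrite /F c0 (proj2 (autz_eq0 (- n) 0)) // mulr0.
have FE n : \sum_(m <- msupp g) F m (n - m) = dirac (- n).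
  rewrite -coef; apply: eq_bigr => m _.
  by rewrite /F addrCA subrr addr0 opprB addrC.
have [n n0|M gM] := conv_concentrated F0 g0 h0.
  by rewrite FE /dirac oppr_eq0 (negPf n0).
(* In degree 0 the only remaining product equals 1, so [sigma^M(h@_(- M))] is a right inverse of
   [g@_M]. *)
rewrite FE /F subrr oppr0 /= /dirac eqxx => /esym gs1.
exists g@_M, (autz sigma (- - M) h@_(- M)), M; split => //.
by rewrite /gwa_expand mmapE gM big_seq_fset1.
Qed.

End GwaOne.

Theorem corollary3p2 (k : fieldType)
    (u : gwa (sigma_inv k) (@central_one k (laurent k))) :
  u \is a GRing.unit ->
  exists (alpha : k) (i j : int),
    alpha != 0 /\
    u = alpha *: (gwa_const (sigma_inv k) central_one (laurent_h ^ i)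
                  * gwa_x ^ j).
Proof.
move=> /(gwa_one_unitP _ _ _ _ (@laurent_mulf_eq0 k))[r [s [j [rs1 ->]]]].
(* The coefficient [r] of the single power of [x] is invertible among Laurent polynomials, hence a
   monomial in [h]. *)
have [c c0 [i ->]] := laurent_unitP _ _ _ rs1.
by exists c, i, j; split; rewrite // linearZ /= scalerAl.
Qed.
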